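(* Let $n\ge 2$, $t\in[n-1]$ and $I=\{t,t+1,\ldots,n-1\}\subset[n-1]$. Then $\mathrm{ASM}^I(n)$ is in bijection with the set of monotone triangles of size $t-1$ with all entries in $\{1,\dots,n\}$.
   Context: $[m]=\{1,\dots,m\}$. An alternating sign matrix (ASM) is a square matrix with entries in $\{0,1,-1\}$ such that the nonzero entries in each row and each column alternate in sign and each row and each column sums to $1$; $\mathrm{ASM}(n)$ is the set of $n\times n$ ASMs. The rank matrix of $A$ is $r_A(i,j)=\sum_{p=1}^i\sum_{q=1}^jA_{p,q}$, with $r_A(0,j)=r_A(i,0)=0$. $\mathrm{ASM}^I(n):=\{A\in\mathrm{ASM}(n)\mid r_A(i,j)\in\{r_A(i-1,j)+1,\ r_A(i+1,j)\}\text{ for all }i\in I,\ j\in[n]\}$. A monotone triangle of size $m$ is a triangular array of integers $(m_{i,j})_{1\le j\le i\le m}$ such that $m_{i,j}\le m_{i-1,j}\le m_{i,j+1}$ for all $1\le j<i\le m$ and $m_{i,j}<m_{i,j+1}$ for all $1\le j<i\le m$. (For size $0$ there is exactly one, the empty triangle.) *)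

(* Defs.v *)
From mathcomp Require Import all_boot all_order all_algebra.

Set Implicit Arguments.
Unset Strict Implicit.
Unset Printing Implicit Defensive.

Import Order.TTheory GRing.Theory Num.Theory.
Local Open Scope ring_scope.

(* Consecutive nonzero terms of [s] have opposite signs. *)
Definition alternating (s : seq int) : bool :=
  sorted (fun x y => x * y < 0) [seq x <- s | x != 0].

Definition is_ASM (n : nat) (A : 'M[int]_n) : bool :=
  [&& [forall i, forall j, A i j \in [:: 0; 1; -1]],
      [forall i, alternating [seq A i j | j <- enum 'I_n]],
      [forall j, alternating [seq A i j | i <- enum 'I_n]],
      [forall i, \sum_j A i j == 1]
    & [forall j, \sum_i A i j == 1]].

(* The arguments [i j] are 1-based as on paper, while the matrix indices [p q]
   are 0-based: hence the strict bounds below. *)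
Definition rank_mx (n : nat) (A : 'M[int]_n) (i j : nat) : int :=
  \sum_(p < n | (p < i)%N) \sum_(q < n | (q < j)%N) A p q.

(* A subset of {1, ..., n-1} is represented as a set [I : {set 'I_n}] which
   does not contain 0. The column index j in {1, ..., n} is [j.+1]. *)
Definition is_ASMI (n : nat) (I : {set 'I_n}) (A : 'M[int]_n) : bool :=
  is_ASM A &&
  [forall i in I, forall j : 'I_n,
     (rank_mx A i j.+1 == rank_mx A i.-1 j.+1 + 1)
     || (rank_mx A i j.+1 == rank_mx A i.+1 j.+1)].

(* A triangular array is the sequence of its rows, the i-th one (from 1) having
   length i; [tri_entry T i j] is its entry with 1-based indices. *)
Definition tri_entry (T : seq (seq int)) (i j : nat) : int :=
  nth 0 (nth [::] T i.-1) j.-1.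

Definition monotone_triangle (m : nat) (T : seq (seq int)) : bool :=
  (shape T == iota 1 m) &&
  all (fun i => all (fun j =>
      [&& tri_entry T i j <= tri_entry T i.-1 j,
          tri_entry T i.-1 j <= tri_entry T i j.+1
        & tri_entry T i j < tri_entry T i j.+1])
    (iota 1 i.-1)) (iota 1 m).

Definition entries_in_1n (n : nat) (T : seq (seq int)) : bool :=
  all (all (fun x => 1 <= x <= n%:Z)) T.

(* Main.v *)
(* Pass from A to its rank matrix K = r_A. A matrix is an ASM iff K grows by 0 or
   1 along each unit step in either direction and K(n,k) = K(k,n) = k. Since the
   jumps of K(i,.) are the elements of a subset of [n] of size i, and two
   consecutive such subsets have counting functions differing by 0 or 1 exactly
   when they interlace, the rows 0, ..., m of K amount to a monotone triangle of
   size m. With m = t - 1, the condition defining ASM^I says, by descending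
   induction from K(n,j) = j, that K(i+1,j) = min(j, K(i,j) + 1) for
   m <= i < n; so the rows of K beyond m are determined by row m, and this
   recurrence always extends row m to a full rank matrix. *)
Require Import Defs.
From mathcomp Require Import all_boot all_order all_algebra zify.

Set Implicit Arguments.
Unset Strict Implicit.
Unset Printing Implicit Defensive.

Import Order.TTheory GRing.Theory Num.Theory.
Local Open Scope ring_scope.

(** * Alternating sequences and their partial sums *)

(* The bit [b] is the partial sum reached so far: it is 1 exactly when the last
   nonzero entry was 1. *)
Lemma path_alternatingP (s : seq int) (b : bool) :
  reflect (forall k, 0 <= b%:Z + \sum_(x <- take k s) x <= 1)
    (all (fun x => x \in [:: 0; 1; -1]) s
     && path (fun x y => x * y < 0) (if b then 1 else -1) [seq x <- s | x != 0]).
Proof.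
apply: (iffP idP); elim: s b => [|x s IHs] b.
- by move=> _ k; rewrite big_nil; case: b.
- rewrite /= !inE -andbA => /andP[x01 /andP[alls pathx]] [|k].
    by rewrite take0 big_nil; case: b {pathx}.
  rewrite big_cons addrA; case/or3P: x01 pathx => /eqP-> /=.
  + by move=> pathx; rewrite addr0; apply: IHs; rewrite alls.
  + case: b => //= pathx; apply: (IHs true); by rewrite alls.
  + case: b => //= pathx; apply: (IHs false); by rewrite alls.
- by [].
move=> sum01; have := sum01 1%N; rewrite /= take0 big_seq1 => x01.
have {}sum01 k : 0 <= b%:Z + x + \sum_(y <- take k s) y <= 1.
  by have := sum01 k.+1; rewrite /= big_cons addrA.
(* The case k = 1 makes [b + x] equal to 0 or 1, so it serves as the next bit. *)
have [b' b'E] : exists b' : bool, b%:Z + x = b'%:Z.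
  by exists (b%:Z + x == 1); lia.
have /andP[-> pathb'] := IHs b' ltac:(by move=> k; rewrite -b'E).
rewrite !inE.
have xE : x = b'%:Z - b%:Z by lia.
by move: pathb'; rewrite xE; case: b {x01 sum01 b'E xE}; case: b' => //=; rewrite ?andbT.
Qed.

(** When the total is 1, the first nonzero entry must be 1, so a virtual entry -1 can be put in
    front of the sequence: the bit starts as [false]. *)
Lemma alternatingP (s : seq int) : \sum_(x <- s) x = 1 ->
  reflect (forall k, 0 <= \sum_(x <- take k s) x <= 1)
    (all (fun x => x \in [:: 0; 1; -1]) s && alternating s).
Proof.
move=> sum1.
have -> : all (fun x => x \in [:: 0; 1; -1]) s && alternating s =
    all (fun x => x \in [:: 0; 1; -1]) s
     && path (fun x y => x * y < 0) (-1) [seq x <- s | x != 0].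
  rewrite /alternating; elim: s sum1 => [|x s IHs] //=.
  rewrite big_cons !inE; case: eqVneq => [->|x0] /=; first by rewrite add0r.
  case: eqVneq => [->|_] //=; case: eqVneq => [->|_] //= sumE.
  (* Here the head is -1, so the tail sums to 2, whereas alternation after -1 keeps its partial sums
     at most 1. *)
  rewrite andbF; apply/negP => /(path_alternatingP _ false) /(_ (size s)).
  rewrite take_size (_ : \sum_(y <- s) y = 2) //.
  by apply: (addrI (-1)); rewrite sumE.
apply: (iffP (path_alternatingP s false)) => + k => /(_ k); by rewrite add0r.
Qed.

Lemma sum_take_enum (n : nat) (F : 'I_n -> int) (k : nat) :
  \sum_(x <- take k [seq F q | q <- enum 'I_n]) x = \sum_(q < n | (q < k)%N) F q.
Proof.
rewrite -map_take big_map.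
have -> : take k (enum 'I_n) = [seq q : 'I_n <- enum 'I_n | (q < k)%N].
  apply: (inj_map val_inj); rewrite map_take val_enum_ord.
  rewrite -(filter_map val (fun x => (x < k)%N)) val_enum_ord.
  have [kn|nk] := leqP k n; first by rewrite take_iota (minn_idPl kn) -(filter_iota_ltn 0 kn).
  rewrite take_oversize ?size_iota ?(ltnW nk) //; apply/esym/all_filterP/allP => x.
  by rewrite mem_iota => /andP[_ /ltn_trans]; apply.
by rewrite big_filter big_enum_cond.
Qed.

(** Stated for a family [F], so that it applies to rows and columns alike. *)
Lemma row_ASMP (n : nat) (F : 'I_n -> int) : \sum_q F q = 1 ->
  reflect (forall k : nat, 0 <= \sum_(q < n | (q < k)%N) F q <= 1)
    ([forall q, F q \in [:: 0; 1; -1]] && alternating [seq F q | q <- enum 'I_n]).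
Proof.
move=> sum1.
have -> : [forall q, F q \in [:: 0; 1; -1]] =
    all (fun x => x \in [:: 0; 1; -1]) [seq F q | q <- enum 'I_n].
  rewrite all_map; apply/forallP/allP => [Fq q _|Fq q]; first exact: Fq.
  by apply: Fq; rewrite mem_enum.
have sumE : \sum_(x <- [seq F q | q <- enum 'I_n]) x = 1 by rewrite big_map big_enum.
by apply: (iffP (alternatingP sumE)) => F01 k; have := F01 k; rewrite sum_take_enum.
Qed.

Lemma ASMP (n : nat) (A : 'M[int]_n) :
  is_ASM A <->
  [/\ forall i, \sum_j A i j = 1, forall j, \sum_i A i j = 1,
      forall i (k : nat), 0 <= \sum_(j < n | (j < k)%N) A i j <= 1
    & forall j (k : nat), 0 <= \sum_(i < n | (i < k)%N) A i j <= 1].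
Proof.
split.
  case/and5P => /forallP entA /forallP rowA /forallP colA.
  move=> /forallP rowA1 /forallP colA1.
  split=> [i|j|i|j]; try exact/eqP.
  - by apply/row_ASMP; [exact/eqP|rewrite entA rowA].
  - apply/(row_ASMP (F := fun i => A i j)); first exact/eqP.
    by rewrite colA andbT; apply/forallP => i; apply: (forallP (entA i)).
case=> rowA1 colA1 /(_ _)/row_ASMP rowA /(_ _)/(row_ASMP (F := fun i => A i _)) colA.
have {}rowA i := andP (rowA i (rowA1 i)); have {}colA j := andP (colA j (colA1 j)).
by apply/and5P; split; apply/forallP => i; by [case: (rowA i)|case: (colA i)|apply/eqP].
Qed.

(** * Rank matrices of ASMs as corner-sum matrices *)

Lemma sum_ltS (n : nat) (F : 'I_n -> int) (i : 'I_n) :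
  \sum_(p < n | (p < i.+1)%N) F p = \sum_(p < n | (p < i)%N) F p + F i.
Proof.
rewrite (bigD1 i) ?ltnSn //= addrC; congr (_ + _); apply: eq_bigl => p.
by rewrite ltnS [in RHS]ltn_neqAle andbC.
Qed.

Lemma sum_lt_all (n : nat) (F : 'I_n -> int) :
  \sum_(p < n | (p < n)%N) F p = \sum_p F p.
Proof. by apply: eq_bigl => p; rewrite ltn_ord. Qed.

Lemma rank_mxSl (n : nat) (A : 'M[int]_n) (i : 'I_n) (j : nat) :
  rank_mx A i.+1 j = rank_mx A i j + \sum_(q < n | (q < j)%N) A i q.
Proof. exact: sum_ltS. Qed.

Lemma rank_mxSr (n : nat) (A : 'M[int]_n) (i : nat) (j : 'I_n) :
  rank_mx A i j.+1 = rank_mx A i j + \sum_(p < n | (p < i)%N) A p j.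
Proof.
by rewrite -big_split; apply: eq_bigr => p _; rewrite sum_ltS.
Qed.

Lemma rank_mx0l (n : nat) (A : 'M[int]_n) (j : nat) : rank_mx A 0 j = 0.
Proof. by rewrite /rank_mx big_pred0. Qed.

Lemma rank_mx0r (n : nat) (A : 'M[int]_n) (i : nat) : rank_mx A i 0 = 0.
Proof. by rewrite /rank_mx big1 // => p _; rewrite big_pred0. Qed.

Definition step01 (x y : int) : bool := (y == x) || (y == x + 1).

Lemma step01D (x d : int) : step01 x (x + d) = (0 <= d <= 1).
Proof. by rewrite /step01; lia. Qed.

Definition corner_sum (n : nat) (K : nat -> nat -> int) : Prop :=
  [/\ forall k, (k <= n)%N -> K 0%N k = 0 /\ K k 0%N = 0,
      forall k, (k <= n)%N -> K n k = k%:Z /\ K k n = k%:Z,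
      forall i j, (i < n)%N -> (j <= n)%N -> step01 (K i j) (K i.+1 j)
    & forall i j, (i <= n)%N -> (j < n)%N -> step01 (K i j) (K i j.+1)].

(** A vertical step of the rank matrix is a partial row sum and a horizontal one a partial column
    sum, so the unit steps are the bounds in [ASMP]; the values on the last row and column encode
    that all lines sum to 1. *)
Lemma ASM_corner_sum (n : nat) (A : 'M[int]_n) :
  is_ASM A <-> corner_sum n (rank_mx A).
Proof.
split=> [/ASMP[rowA1 colA1 rowA colA]|[_ An Al Ar]].
  split.
  - by move=> k _; rewrite rank_mx0l rank_mx0r.
  - elim=> [|k IHk] kn; first by rewrite rank_mx0l rank_mx0r.
    have [IH1 IH2] := IHk (ltnW kn).
    rewrite (rank_mxSl A (Ordinal kn)) (rank_mxSr A _ (Ordinal kn)) IH1 IH2.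
    by rewrite !sum_lt_all rowA1 colA1; split; lia.
  - move=> i j ilt jn; rewrite (rank_mxSl A (Ordinal ilt)) step01D.
    exact: rowA.
  - move=> i j ilt jn; rewrite (rank_mxSr A _ (Ordinal jn)) step01D.
    exact: colA.
(* [corner_sum] controls indices up to n only; longer prefixes are full sums. *)
have big_all (F : 'I_n -> int) (k : nat) : (n <= k)%N ->
    \sum_(p < n | (p < k)%N) F p = \sum_p F p.
  by move=> nk; apply: eq_bigl => p; rewrite (leq_trans (ltn_ord p)).
have rowA1 i : \sum_j A i j = 1.
  rewrite -sum_lt_all; apply: (addrI (rank_mx A i n)); rewrite -rank_mxSl.
  by have [_ ->] := An i.+1 (ltn_ord i); have [_ ->] := An i (ltnW (ltn_ord i)); lia.
have colA1 j : \sum_i A i j = 1.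
  rewrite -sum_lt_all; apply: (addrI (rank_mx A n j)); rewrite -rank_mxSr.
  by have [-> _] := An j.+1 (ltn_ord j); have [-> _] := An j (ltnW (ltn_ord j)); lia.
apply/ASMP; split=> // i k.
- have [nk|kn] := leqP n k; first by rewrite big_all // rowA1.
  by have := Al i k (ltn_ord i) (ltnW kn); rewrite rank_mxSl step01D.
- have [nk|kn] := leqP n k; first by rewrite big_all // colA1.
  by have := Ar k i (ltnW kn) (ltn_ord i); rewrite rank_mxSr step01D.
Qed.

(** The mixed second difference, which inverts the double summation [rank_mx]. *)
Definition mx_of_corner (n : nat) (K : nat -> nat -> int) : 'M[int]_n :=
  \matrix_(i, j) (K i.+1 j.+1 - K i j.+1 - (K i.+1 j - K i j)).

Lemma rank_mx_of_corner (n : nat) (K : nat -> nat -> int) (i j : nat) :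
  corner_sum n K -> (i <= n)%N -> (j <= n)%N -> rank_mx (mx_of_corner n K) i j = K i j.
Proof.
case=> K0 _ _ _ + jn; elim: i => [|i IHi] ilt.
  by rewrite rank_mx0l; have [-> _] := K0 j jn.
rewrite (rank_mxSl _ (Ordinal ilt)) IHi ?(ltnW ilt) //=.
suff -> : \sum_(q < n | (q < j)%N) mx_of_corner n K (Ordinal ilt) q = K i.+1 j - K i j.
  by rewrite addrC subrK.
elim: j jn {IHi} => [|j IHj] jn.
  by rewrite big_pred0 //; have [_ ->] := K0 i.+1 ilt; have [_ ->] := K0 i (ltnW ilt).
by rewrite (sum_ltS _ (Ordinal jn)) IHj ?(ltnW jn) // mxE /= addrC subrK.
Qed.

Lemma mx_of_rank_mx (n : nat) (A : 'M[int]_n) : mx_of_corner n (rank_mx A) = A.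
Proof.
apply/matrixP => i j; rewrite mxE !rank_mxSl [\sum_(q < n | (q < j.+1)%N) _]sum_ltS.
by rewrite !(addrC (rank_mx A i _)) !addrK addrC addKr.
Qed.

Lemma eq_mx_of_corner (n : nat) (K L : nat -> nat -> int) :
  (forall i j, (i <= n)%N -> (j <= n)%N -> K i j = L i j) ->
  mx_of_corner n K = mx_of_corner n L.
Proof. by move=> KL; apply/matrixP => i j; rewrite !mxE !KL // ltnW. Qed.

(** * The condition of ASM^I as a recurrence on rows *)

Lemma corner_sum_le (n : nat) (K : nat -> nat -> int) (i j : nat) :
  corner_sum n K -> (i <= n)%N -> (j <= n)%N -> K i j <= j%:Z.
Proof.
case=> K0 _ _ Kr ilt; elim: j => [|j IHj] jn; first by have [_ ->] := K0 i ilt.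
by have := IHj (ltnW jn); have := Kr i j ilt jn; rewrite /step01; lia.
Qed.

(** Beyond row m, each row is as large as the cap j and the unit growth permit. *)
Definition saturated (n m : nat) (K : nat -> nat -> int) : Prop :=
  forall i j : nat, (m <= i < n)%N -> (j <= n)%N ->
  K i.+1 j = Num.min j%:Z (K i j + 1).

(** A value that has reached the cap stays there, so the iterated minima collapse into one. *)
Lemma saturatedE (n m : nat) (K : nat -> nat -> int) (i j : nat) :
  saturated n m K -> (m <= i <= n)%N -> (j <= n)%N -> K m j <= j%:Z ->
  K i j = Num.min j%:Z (K m j + (i - m)%:Z).
Proof.
move=> satK /andP[mi +] jn Kmj; rewrite -{1 2}(subnKC mi).
elim: (i - m)%N => [|d IHd] dn; first by rewrite addn0; lia.
by rewrite addnS satK ?IHd; lia.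
Qed.

Lemma ASMI_corner_sum (n t : nat) (A : 'M[int]_n) : (0 < t)%N ->
  is_ASMI [set i : 'I_n | (t <= i)%N] A <->
  corner_sum n (rank_mx A) /\ saturated n t.-1 (rank_mx A).
Proof.
move=> t0; rewrite /is_ASMI.
split=> [/andP[/ASM_corner_sum cK /forallP condA]|[cK satK]].
  split=> // i j iP jn; have Kle k (kn : (k <= n)%N) := corner_sum_le cK kn jn.
  have [K0 Kn Kl _] := cK.
  (* Given the cap and the unit steps, saturation means: grow, or be at the cap already. *)
  suff : rank_mx A i.+1 j = rank_mx A i j + 1 \/ rank_mx A i j = j%:Z.
    by have := Kl i j ltac:(lia) jn; have := Kle i ltac:(lia);
       have := Kle i.+1 ltac:(lia); rewrite /step01; lia.
  (* Descending induction on i, with d = n - 1 - i; it starts from r(n,j) = j. *)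
  have [d dE] : exists d, (i + d).+1 = n by exists (n - i.+1)%N; lia.
  elim: d i dE iP => [|d IHd] i dE iP.
    have iE : i.+1 = n by lia.
    have [Kj _] := Kn j jn.
    by have := Kl i j ltac:(lia) jn; rewrite /step01 iE Kj; lia.
  have {}IHd := IHd i.+1 ltac:(lia) ltac:(lia).
  have stepi := Kl i j ltac:(lia) jn.
  have iltn : (i.+1 < n)%N by lia.
  (* Column 0 is split off because the condition of ASM^I concerns j >= 1. *)
  case: j jn Kle IHd stepi => [|j] jn Kle IHd stepi.
    by right; have [_ ->] := K0 i ltac:(lia).
  (* Either row i+1 has grown from row i, or it equals row i+2; then the induction hypothesis puts
     row i+1 at the cap, and row i is at the cap or one below. *)
  have := condA (Ordinal iltn); rewrite inE /=.
  have -> /= : (t <= i.+1)%N by lia.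
  move=> /forallP /(_ (Ordinal jn)) /=.
  by move: stepi; rewrite /step01; lia.
apply/andP; split; first exact/ASM_corner_sum.
apply/forallP => i; apply/implyP; rewrite inE => ti; apply/forallP => j.
have [p pE] : exists p, nat_of_ord i = p.+1 by exists i.-1; lia.
have ilt := ltn_ord i; have jlt := ltn_ord j.
(* If row p+1 is not one more than row p, it is at the cap, and then so is row p+2. *)
rewrite pE /=; have := satK p j.+1 ltac:(lia) jlt.
by have := satK p.+1 j.+1 ltac:(lia) jlt; lia.
Qed.

(** * Subsets of [n], their counting functions, and interlacing *)

Definition count_upto (s : seq int) (x : int) : nat := count (<= x) s.

(** This adjunction between positions and counts converts inequalities between entries into
    inequalities between counting functions. *)
Lemma nth_le_count_upto (s : seq int) (x : int) (k : nat) :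
  sorted <%R s -> (k < size s)%N -> (nth 0 s k <= x) = (k < count_upto s x)%N.
Proof.
move=> /(sub_sorted (@ltW _ _)) ss ks; apply/idP/idP => [|/(nth_count_le 0 ss)//].
by apply: contraLR; rewrite -leqNgt -ltNge => ck; apply: nth_count_gt; rewrite ?ck.
Qed.

(** Encodes an i-element subset of {1, ..., n} by its increasing enumeration. *)
Definition valid_row (n i : nat) (s : seq int) : bool :=
  [&& size s == i, sorted <%R s & all (fun x => 1 <= x <= n%:Z) s].

Lemma valid_row_count (n i : nat) (s : seq int) :
  valid_row n i s -> count_upto s n%:Z = i.
Proof.
case/and3P => /eqP <- _ /allP sn; apply/eqP; rewrite /count_upto -all_count.
by apply/allP => x /sn /andP[].
Qed.

Lemma valid_row_count0 (n i : nat) (s : seq int) :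
  valid_row n i s -> count_upto s 0 = 0%N.
Proof.
case/and3P => _ _ /allP sn; apply/eqP; rewrite /count_upto -leqn0 leqNgt -has_count.
by apply/hasP => -[x /sn] /=; lia.
Qed.

Lemma count_uptoS (s : seq int) (j : nat) : uniq s ->
  count_upto s j.+1%:Z = (count_upto s j%:Z + (j.+1%:Z \in s))%N.
Proof.
move=> us; rewrite /count_upto -(count_uniq_mem _ us) -count_predUI.
rewrite [X in (_ + X)%N](@eq_count _ _ pred0) => [|x /=]; last by lia.
by rewrite count_pred0 addn0; apply: eq_count => x /=; lia.
Qed.

(** Membership of j+1 is the increment of the counting function from j to j+1, and a sorted list is
    determined by its members. *)
Lemma valid_row_inj (n i i' : nat) (s s' : seq int) :
  valid_row n i s -> valid_row n i' s' ->
  (forall j, (j <= n)%N -> count_upto s j%:Z = count_upto s' j%:Z) -> s = s'.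
Proof.
case/and3P => _ ss /allP sn /and3P[_ ss' /allP sn'] cnt.
apply: lt_sorted_eq => // x.
have [x1n|xN] := boolP (1 <= x <= n%:Z); last first.
  by apply/idP/idP => [/sn|/sn'] xE; rewrite xE in xN.
have [j xE] : exists j : nat, x = j.+1%:Z by exists `|x - 1|%N; lia.
have := cnt j.+1 ltac:(lia).
rewrite !count_uptoS ?lt_sorted_uniq // cnt; last by lia.
by move/addnI; rewrite -xE; do 2!case: (x \in _).
Qed.

(** If u_c <= x then s_c <= x, and if s_{c+1} <= x then u_c <= x; take c to be the last position
    counted. *)
Lemma interlace_count (s u : seq int) (x : int) :
  sorted <%R s -> sorted <%R u -> size s = (size u).+1 ->
  (forall k, (k < size u)%N -> nth 0 s k <= nth 0 u k <= nth 0 s k.+1) ->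
  (count_upto u x <= count_upto s x <= (count_upto u x).+1)%N.
Proof.
move=> ss su sz il; apply/andP; split.
  case cE: (count_upto u x) => [|c] //.
  have cu : (c < size u)%N by rewrite -cE; apply: count_size.
  have /andP[skuk _] := il c cu.
  by rewrite -nth_le_count_upto ?sz ?(leq_trans cu) // (le_trans skuk) // nth_le_count_upto ?cE.
case cE: (count_upto s x) => [|[|c]] //.
have cs : (c.+1 < size s)%N by rewrite -cE; apply: count_size.
have cu : (c < size u)%N by lia.
have /andP[_ uksk] := il c cu.
by rewrite ltnS -nth_le_count_upto // (le_trans uksk) // nth_le_count_upto ?cE.
Qed.

(** Taking x = u_k gives the left inequality and x = s_{k+1} the right one. Restricting x to entries
    keeps it within [1,n], where the rows of K are controlled. *)
Lemma count_interlace (s u : seq int) :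
  sorted <%R s -> sorted <%R u -> size s = (size u).+1 ->
  (forall x, x \in s ++ u ->
     (count_upto u x <= count_upto s x <= (count_upto u x).+1)%N) ->
  forall k, (k < size u)%N -> nth 0 s k <= nth 0 u k <= nth 0 s k.+1.
Proof.
move=> ss su sz cnt k ku; have ks : (k.+1 < size s)%N by rewrite sz.
have uk : nth 0 u k \in s ++ u by rewrite mem_cat mem_nth ?orbT.
have sk : nth 0 s k.+1 \in s ++ u by rewrite mem_cat mem_nth.
apply/andP; split.
  rewrite nth_le_count_upto ?(ltnW ks) //; have /andP[+ _] := cnt _ uk.
  by apply: leq_trans; rewrite -nth_le_count_upto.
rewrite nth_le_count_upto // -ltnS; have /andP[_] := cnt _ sk.
by apply: leq_trans; rewrite -nth_le_count_upto.
Qed.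

Definition jumps (n : nat) (k : nat -> int) : seq int :=
  [seq j.+1%:Z | j <- iota 0 n & k j.+1 != k j].

(** Every jump has height one, so counting the jumps telescopes to [k j]. *)
Lemma count_jumps (n j : nat) (k : nat -> int) : k 0%N = 0 ->
  (forall j, (j < n)%N -> step01 (k j) (k j.+1)) -> (j <= n)%N ->
  (count_upto (jumps n k) j%:Z)%:Z = k j.
Proof.
move=> k0 kS jn; rewrite /count_upto count_map count_filter.
rewrite -(@eq_count _ (predI (fun i => k i.+1 != k i) (fun i => i < 0 + j)%N)); last first.
  by move=> i /=; rewrite andbC; congr andb; lia.
rewrite -count_filter (filter_iota_ltn _ jn); elim: j jn => [|j IHj] jn //.
rewrite -addn1 iotaD count_cat PoszD IHj ?(ltnW jn) //= add0n addn0 addn1.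
by have := kS j jn; rewrite /step01; lia.
Qed.

Lemma valid_jumps (n i : nat) (k : nat -> int) : k 0%N = 0 ->
  (forall j, (j < n)%N -> step01 (k j) (k j.+1)) -> k n = i%:Z ->
  valid_row n i (jumps n k).
Proof.
move=> k0 kS kn.
have jumpsn : all (fun x => 1 <= x <= n%:Z) (jumps n k).
  apply/allP => x /mapP[j]; rewrite mem_filter mem_iota => jP ->; lia.
apply/and3P; split=> //.
  have := count_jumps k0 kS (leqnn n); rewrite kn => -[<-].
  rewrite eq_sym /count_upto -all_count; apply: sub_all jumpsn => x; by case/andP.
rewrite sorted_map; apply: sorted_filter; first by move=> x y z /=; lia.
by apply: sub_sorted (iota_ltn_sorted 0 n) => x y /=; lia.
Qed.

(** * Monotone triangles as chains of interlacing subsets *)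

(* Row [i] with the paper's 1-based numbering, preceded by an empty row 0. *)
Definition trow (T : seq (seq int)) (i : nat) : seq int := nth [::] ([::] :: T) i.

Lemma monotone_triangleP (n m : nat) (T : seq (seq int)) :
  monotone_triangle m T && entries_in_1n n T <->
  [/\ size T = m, forall i, (i <= m)%N -> valid_row n i (trow T i)
    & forall i k, (i < m)%N -> (k < i)%N ->
      nth 0 (trow T i.+1) k <= nth 0 (trow T i) k <= nth 0 (trow T i.+1) k.+1].
Proof.
split=> [/andP[/andP[/eqP shT /allP monT] /allP entT]|[szT rowT intT]].
  have szT : size T = m by rewrite -(size_map size) -/(shape T) shT size_iota.
  have ineq i k : (i < m)%N -> (k < i)%N ->
      [&& nth 0 (trow T i.+1) k <= nth 0 (trow T i) k,
          nth 0 (trow T i) k <= nth 0 (trow T i.+1) k.+1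
        & nth 0 (trow T i.+1) k < nth 0 (trow T i.+1) k.+1].
    case: i => // i im ki.
    have /monT/allP/(_ k.+1) : i.+2 \in iota 1 m by rewrite mem_iota; lia.
    by apply; rewrite mem_iota; lia.
  split=> // [[|i] im|i k im ki]; last by have /and3P[-> ->] := ineq i k im ki.
    by [].
  have szrow : size (trow T i.+1) = i.+1.
    by have := congr1 (nth 0%N ^~ i) shT; rewrite (nth_map [::]) ?szT // nth_iota.
  apply/and3P; split.
  - by rewrite szrow.
  - apply/(sortedP 0) => k; rewrite szrow => ki.
    by have /and3P[] := ineq i k im ltac:(lia).
  - by apply: entT; rewrite /trow /= mem_nth ?szT.
apply/andP; split; last first.
  apply/(all_nthP [::]) => i; rewrite szT => im.
  by have /and3P[] := rowT i.+1 im.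
apply/andP; split.
  apply/eqP/(@eq_from_nth _ 0%N); first by rewrite size_map size_iota.
  move=> i; rewrite size_map szT => im; rewrite (nth_map [::]) ?szT // nth_iota //.
  by have /and3P[/eqP] := rowT i.+1 im.
apply/allP => -[|i]; rewrite mem_iota // => im; apply/allP => -[|k]; rewrite mem_iota //= => ki.
case: i im ki => [|i] im ki; first by lia.
have /andP[le1 le2] := intT i.+1 k ltac:(lia) ltac:(lia).
apply/and3P; split=> //; rewrite /tri_entry /=.
have /and3P[/eqP sz /(sortedP 0) srt _] := rowT i.+2 ltac:(lia).
by apply: srt; rewrite sz; lia.
Qed.

(** * From triangles to corner sums *)

(** Beyond row m this is the closed form found in [saturatedE]. *)
Definition tri_corner (m : nat) (T : seq (seq int)) (i j : nat) : int :=
  if (i <= m)%N then (count_upto (trow T i) j%:Z)%:Z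
  else Num.min j%:Z ((count_upto (trow T m) j%:Z)%:Z + (i - m)%:Z).

Lemma valid_row_step (n i j : nat) (s : seq int) : valid_row n i s ->
  step01 (count_upto s j%:Z)%:Z (count_upto s j.+1%:Z)%:Z.
Proof.
case/and3P => _ ss _; rewrite count_uptoS ?lt_sorted_uniq // PoszD step01D.
by case: (_ \in _).
Qed.

(** At most n - j of the i elements exceed j, and at most j do not. The lower bound is what lets
    saturation reach K(n,j) = j. *)
Lemma valid_row_count_bounds (n i j : nat) (s : seq int) :
  valid_row n i s -> (j <= n)%N ->
  (i + j - n <= count_upto s j%:Z <= j)%N.
Proof.
move=> rs jn; apply/andP; split.
  (* Descend from column n, where the count is i, losing at most one per column. *)
  have -> : j = (n - (n - j))%N by lia.
  have : (n - j <= n)%N by lia.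
  elim: (n - j)%N => [|d IHd] dn; first by rewrite subn0 (valid_row_count rs); lia.
  have := IHd (ltnW dn); have := valid_row_step (n - d.+1) rs.
  have -> : (n - d.+1).+1 = (n - d)%N by lia.
  by rewrite /step01; lia.
elim: j {jn} => [|j IHj]; first by rewrite (valid_row_count0 rs).
by have := valid_row_step j rs; rewrite /step01; lia.
Qed.

Section TriangleToASM.

Variables (n m : nat) (T : seq (seq int)).
Hypotheses (mn : (m <= n)%N) (T_ok : monotone_triangle m T && entries_in_1n n T).

Let K := tri_corner m T.

Lemma tri_corner_saturated : saturated n m K.
Proof.
move=> i j /andP[mi iltn] jn; have [_ rowT _] := (monotone_triangleP n m T).1 T_ok.
rewrite /K /tri_corner ltnNge mi /=.
have /andP[_ cj] := valid_row_count_bounds (rowT m (leqnn m)) jn.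
case: (leqP i m) => im /=; last by lia.
have -> : i = m by lia.
by lia.
Qed.

Lemma tri_corner_corner_sum : corner_sum n K.
Proof.
have [szT rowT intT] := (monotone_triangleP n m T).1 T_ok.
have bnd j (jn : (j <= n)%N) := valid_row_count_bounds (rowT m (leqnn m)) jn.
have satK := tri_corner_saturated.
have Kle i j : (i <= n)%N -> (j <= n)%N -> K i j <= j%:Z.
  move=> iltn jn; rewrite /K /tri_corner; case: (leqP i m) => im /=; last by lia.
by have := valid_row_count_bounds (rowT i im) jn; lia.
split.
- move=> k kn; rewrite /K /tri_corner /=; split=> //.
  by case: (leqP k m) => im /=; rewrite (valid_row_count0 (rowT _ _)) //; lia.
- move=> k kn; rewrite /K /tri_corner; split.
    (* The count in row m is at least m + k - n, so n - m further increments attain the cap k. *)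
    case: (leqP n m) => im /=; last by have := bnd k kn; lia.
    have nm : m = n by lia.
    by have := bnd k kn; rewrite nm; lia.
  by case: (leqP k m) => im /=; rewrite (valid_row_count (rowT _ _)) //; lia.
- move=> i j iltn jn; have [im|mi] := ltnP i m; last first.
    have := satK i j ltac:(lia) jn; have := Kle i j (ltnW iltn) jn.
    by rewrite /step01; lia.
  rewrite /K /tri_corner (ltnW im) im.
  have /and3P[/eqP sz1 s1 _] := rowT i.+1 im.
  have /and3P[/eqP sz0 s0 _] := rowT i (ltnW im).
  have := @interlace_count _ _ j%:Z s1 s0 ltac:(by rewrite sz1 sz0).
  rewrite sz0 => /(_ (fun k => intT i k im)).
  by rewrite /step01; lia.
- move=> i j iltn jn; rewrite /K /tri_corner; case: (leqP i m) => im /=.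
    exact: valid_row_step (rowT i im).
  (* Both arguments of the minimum grow by 0 or 1, hence so does the minimum. *)
  by have := valid_row_step j (rowT m (leqnn m)); rewrite /step01; lia.
Qed.

End TriangleToASM.

(** * From corner sums to triangles *)

Section ASMToTriangle.

Variables (n m : nat) (K : nat -> nat -> int).
Hypotheses (mn : (m <= n)%N) (K_corner : corner_sum n K).

Definition tri_of_corner : seq (seq int) := [seq jumps n (K i) | i <- iota 1 m].

Lemma valid_row_corner (i : nat) : (i <= n)%N -> valid_row n i (jumps n (K i)).
Proof.
case: K_corner => K0 Kn _ Kr ilt; apply: valid_jumps => [|j jn|].
- by have [] := K0 i ilt.
- exact: Kr.
- by have [] := Kn i ilt.
Qed.

Lemma trow_tri_of_corner (i : nat) : (i <= m)%N ->
  trow tri_of_corner i = jumps n (K i).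
Proof.
case: i => [|i] im; last by rewrite /trow /= (nth_map 0%N) ?size_iota // nth_iota.
(* Row 0 of K has no jumps, which agrees with the empty row prepended by [trow]. *)
by have /and3P[/nilP-> _ _] := valid_row_corner (leq0n n).
Qed.

Lemma count_jumps_corner (i j : nat) : (i <= n)%N -> (j <= n)%N ->
  (count_upto (jumps n (K i)) j%:Z)%:Z = K i j.
Proof.
case: K_corner => K0 _ _ Kr ilt; apply: count_jumps => [|k]; last exact: Kr.
by have [] := K0 i ilt.
Qed.

Lemma tri_of_corner_monotone :
  monotone_triangle m tri_of_corner && entries_in_1n n tri_of_corner.
Proof.
apply/(monotone_triangleP n m); split.
- by rewrite size_map size_iota.
- by move=> i im; rewrite trow_tri_of_corner // valid_row_corner // (leq_trans im).
move=> i k im ki; rewrite !trow_tri_of_corner ?(ltnW im) //.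
have iltn := leq_trans im mn.
have /and3P[/eqP sz1 s1 /allP e1] := valid_row_corner iltn.
have /and3P[/eqP sz0 s0 /allP e0] := valid_row_corner (ltnW iltn).
apply: count_interlace => //; rewrite ?sz0 ?sz1 // => x.
rewrite mem_cat => xP.
have x1n : 1 <= x <= n%:Z by case/orP: xP => [/e1|/e0].
have [j xE] : exists j : nat, x = j by exists `|x|%N; lia.
have jn : (j <= n)%N by lia.
have [_ _ Kl _] := K_corner; have := Kl i j iltn jn.
by rewrite xE -!count_jumps_corner ?(ltnW iltn) // /step01; lia.
Qed.

(** Up to row m the jumps recover K; beyond it saturation leaves no freedom. *)
Lemma tri_of_cornerK (i j : nat) : saturated n m K -> (i <= n)%N -> (j <= n)%N ->
  tri_corner m tri_of_corner i j = K i j.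
Proof.
move=> satK ilt jn; rewrite /tri_corner.
case: (leqP i m) => im; rewrite trow_tri_of_corner //; first exact: count_jumps_corner.
rewrite count_jumps_corner // (saturatedE (i := i) satK) ?(ltnW im) //.
exact: corner_sum_le K_corner mn jn.
Qed.

End ASMToTriangle.

(** * The two maps are mutually inverse *)

(** K stands for the rank matrix of the reconstructed ASM, known to agree with [tri_corner m T] for
    indices up to n. *)
Lemma tri_cornerK (n m : nat) (T : seq (seq int)) (K : nat -> nat -> int) :
  (m <= n)%N -> monotone_triangle m T && entries_in_1n n T -> corner_sum n K ->
  (forall i j, (i <= n)%N -> (j <= n)%N -> K i j = tri_corner m T i j) ->
  tri_of_corner n m K = T.
Proof.
move=> mn T_ok cK KE; have [szT rowT _] := (monotone_triangleP n m T).1 T_ok.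
apply: (@eq_from_nth _ [::]); first by rewrite size_map size_iota.
move=> i; rewrite size_map size_iota => im.
have iltn := leq_trans im mn.
rewrite -/(trow T i.+1) -[LHS]/(trow (tri_of_corner n m K) i.+1) trow_tri_of_corner //.
apply: (valid_row_inj (valid_row_corner cK iltn) (rowT _ im)) => j jn.
have := count_jumps_corner cK iltn jn.
by rewrite KE // /tri_corner im => -[].
Qed.

Theorem proposition1p3 (n t : nat) (hn : (2 <= n)%N) (ht : (1 <= t <= n - 1)%N) :
  exists f : {A : 'M[int]_n | is_ASMI [set i : 'I_n | (t <= i)%N] A} ->
             {T : seq (seq int) | monotone_triangle (t - 1) T && entries_in_1n n T},
    bijective f.
Proof.
have t0 : (0 < t)%N by case/andP: ht.
have mn : (t - 1 <= n)%N by lia.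
have fP (A : {A : 'M[int]_n | is_ASMI [set i : 'I_n | (t <= i)%N] A}) :
    monotone_triangle (t - 1) (tri_of_corner n (t - 1) (rank_mx (sval A)))
    && entries_in_1n n (tri_of_corner n (t - 1) (rank_mx (sval A))).
  by apply: tri_of_corner_monotone => //; case/(ASMI_corner_sum _ t0): (svalP A).
have rankE T : monotone_triangle (t - 1) T && entries_in_1n n T ->
    forall i j, (i <= n)%N -> (j <= n)%N ->
    rank_mx (mx_of_corner n (tri_corner (t - 1) T)) i j = tri_corner (t - 1) T i j.
  by move=> T_ok i j; apply: rank_mx_of_corner; apply: tri_corner_corner_sum.
have gP (T : {T : seq (seq int) | monotone_triangle (t - 1) T && entries_in_1n n T}) :
    is_ASMI [set i : 'I_n | (t <= i)%N] (mx_of_corner n (tri_corner (t - 1) (sval T))).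
  have [T_ok rankT] := (svalP T, rankE _ (svalP T)).
  apply/(ASMI_corner_sum _ t0); rewrite -subn1; split.
    have [K0 Kn Kl Kr] := tri_corner_corner_sum mn T_ok.
    split=> [k kn|k kn|i j ilt jn|i j ilt jn]; rewrite !rankT ?(ltnW ilt) ?(ltnW jn) //.
    - exact: K0.
    - exact: Kn.
    - exact: Kl.
    - exact: Kr.
  move=> i j iP jn; have /andP[_ iltn] := iP.
  by rewrite !rankT ?(ltnW iltn) //; apply: (tri_corner_saturated mn T_ok).
exists (fun A => exist _ (tri_of_corner n (t - 1) (rank_mx (sval A))) (fP A)).
exists (fun T => exist _ (mx_of_corner n (tri_corner (t - 1) (sval T))) (gP T)) => [A|T].
  (* A is the second difference of its own rank matrix, so comparing corner sums suffices. *)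
  apply/val_inj => /=; have [cK] := (ASMI_corner_sum _ t0).1 (svalP A).
  rewrite -subn1 => satK; rewrite -[RHS]mx_of_rank_mx.
  by apply: eq_mx_of_corner => i j ilt jn; apply: tri_of_cornerK.
apply/val_inj => /=; apply: tri_cornerK (svalP T) _ (rankE _ (svalP T)) => //.
by have [] := (ASMI_corner_sum _ t0).1 (gP T).
Qed.
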